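(* Let $n\ge2$, $m\in\mathbb Z_{>0}$, and let $\theta\in\operatorname{Int}(\mathfrak{sl}_n\mathbb C)$ be an inner automorphism of order $m$. Then the $\mathbb Z/m\mathbb Z$-grading of $\mathfrak g=\mathfrak{sl}_n\mathbb C$ given by $\theta$ lifts to a $\mathbb Z$-grading of the form $$\mathfrak g=\mathfrak g_{1-m}\oplus\dots\oplus\mathfrak g_0\oplus\dots\oplus\mathfrak g_{m-1}.$$
   Context: Let $\zeta_m=\exp(2\pi i/m)$. An order $m$ automorphism $\theta$ of $\mathfrak g$ gives the $\mathbb Z/m\mathbb Z$-grading $\mathfrak g=\bigoplus_{j\in\mathbb Z/m\mathbb Z}\bar{\mathfrak g}_j$ with $\bar{\mathfrak g}_j=\{x:\theta(x)=\zeta_m^jx\}$. A $\mathbb Z$-grading is a decomposition $\mathfrak g=\bigoplus_{j\in\mathbb Z}\mathfrak g_j$ with $[\mathfrak g_j,\mathfrak g_k]\subseteq\mathfrak g_{j+k}$. The $\mathbb Z/m\mathbb Z$-grading lifts to the $\mathbb Z$-grading if $\bar{\mathfrak g}_j=\bigoplus_{k\equiv j\bmod m}\mathfrak g_k$ for all $j$. The displayed form means that $\mathfrak g_j=0$ for $|j|\ge m$ (so $\bar{\mathfrak g}_0=\mathfrak g_0$). *)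

(* Defs.v *)
From HB Require Import structures.
From mathcomp Require Import all_boot all_order all_algebra.
From mathcomp Require Import complex.
From mathcomp Require Import all_classical all_reals all_analysis.

Set Implicit Arguments.
Unset Strict Implicit.
Unset Printing Implicit Defensive.

Import Order.TTheory GRing.Theory Num.Theory.
Import numFieldNormedType.Exports.

Local Open Scope classical_set_scope.
Local Open Scope ring_scope.

(* exp(2 pi i / m), by Euler's formula *)
Definition zeta (R : realType) (m : nat) : R[i] :=
  (cos (2 * pi / m%:R) +i* sin (2 * pi / m%:R))%C.

Definition sln (C : numFieldType) (n : nat) : {vspace 'M[C]_n} :=
  lker (linfun (mxtrace : 'M[C]_n -> C^o)).

Lemma mem_sln (C : numFieldType) (n : nat) (A : 'M[C]_n) :
  (A \in sln C n) = (\tr A == 0).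
Proof. by rewrite memv_ker lfunE. Qed.

Notation slT C n := (subvs_of (sln C n)).

Section SpecialLinear.
Variables (C : numFieldType) (n : nat).
Implicit Types (x y : slT C n) (phi psi : 'End(slT C n)).

Lemma lie_bracket_subproof x y :
  vsval x *m vsval y - vsval y *m vsval x \in sln C n.
Proof. by rewrite mem_sln linearB /= mxtrace_mulC subrr. Qed.

Definition lie_bracket x y : slT C n := Subvs (lie_bracket_subproof x y).

(* phi = exp(ad x) = \sum_k (ad x)^k / k!, as a pointwise limit; slT carries
   no topology of its own, so the limit is taken in the space of matrices. *)
Definition is_exp_ad x phi : Prop :=
  forall y : slT C n,
    (series (fun k => k`!%:R^-1 *: vsval (iter k (lie_bracket x) y))
       : nat -> 'M[C]_n) @ \oo --> vsval (phi y).

(* Int(g): the group generated by the exp(ad x), x in g.  The pseudo-inverse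
   phi^-1 is the inverse here, all members being bijective over the complex
   numbers. *)
Inductive Int : 'End(slT C n) -> Prop :=
| Int_exp_ad x phi of is_exp_ad x phi : Int phi
| Int_id : Int \1%VF
| Int_comp phi psi of Int phi & Int psi : Int (phi \o psi)%VF
| Int_inv phi of Int phi : Int phi^-1%VF.

Definition has_order phi (m : nat) : Prop :=
  [/\ (0 < m)%N,
      forall x, iter m phi x = x &
      forall k : nat, (0 < k < m)%N -> ~ (forall x, iter k phi x = x)].

(* U is the (internal) direct sum of the g_k, over all integers k with P k. *)
Definition is_direct_sum (g : int -> {vspace slT C n}) (P : pred int)
    (U : {vspace slT C n}) : Prop :=
  (forall s : seq int, uniq s -> directv (\sum_(k <- s | P k) g k)%VS) /\
  (forall x, x \in U <->
     exists s : seq int, x \in (\sum_(k <- s | P k) g k)%VS).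

Definition Z_grading (g : int -> {vspace slT C n}) : Prop :=
  is_direct_sum g predT fullv /\
  (forall (j k : int) (x y : slT C n),
     x \in g j -> y \in g k -> lie_bracket x y \in g (j + k)).

(* Families indexed by Z/mZ are represented as m-periodic families on int. *)
Definition lifts (m : nat) (gbar g : int -> {vspace slT C n}) : Prop :=
  forall j : int, is_direct_sum g (fun k => (k == j %[mod m])%Z) (gbar j).

End SpecialLinear.

Definition cyclic_grading (R : realType) (n m : nat) (theta : 'End(slT R[i] n))
    (j : int) : {vspace slT R[i] n} :=
  passmx.leigenspace theta (zeta R m ^ j).

Lemma mem_cyclic_grading (R : realType) (n m : nat) (theta : 'End(slT R[i] n))
    (j : int) (x : slT R[i] n) :
  (x \in cyclic_grading m theta j) = (theta x == zeta R m ^ j *: x).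
Proof. by rewrite memv_ker add_lfunE opp_lfunE scale_lfunE id_lfunE subr_eq0. Qed.

(* Main.v *)
(* Every phi = exp(ad x) extends to an algebra endomorphism Phi of the full
   matrix algebra: by Leibniz, Phi (Y Z) - Phi Y Phi Z is the limit of remainders
   of a Cauchy product, which are dominated by those of exp(M)^2 = exp(2M).
   Skolem-Noether then makes Phi, hence every member of Int(sl_n), a conjugation
   by some invertible P; no matrix exponential has to be constructed.
   If theta = Ad P has order m, then P^m is scalar, so after rescaling P^m = 1
   and P is diagonalizable with eigenvalues zeta^(a_i), 0 <= a_i < m.  In an
   eigenbasis, giving the elementary matrix E_ij the degree a_i - a_j defines a
   Z-grading with degrees in ]-m, m[, on which theta acts by zeta^(degree). *)
From HB Require Import structures.
Require Import Defs.
From mathcomp Require Import all_boot all_order all_algebra.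
From mathcomp Require Import complex.
From mathcomp Require Import all_classical all_reals all_analysis.
From mathcomp Require Import ring zify.

Set Implicit Arguments.
Unset Strict Implicit.
Unset Printing Implicit Defensive.

Import Order.TTheory GRing.Theory Num.Theory.
Import numFieldNormedType.Exports.
Import ComplexField.Normc.

Local Open Scope classical_set_scope.
Local Open Scope ring_scope.

(** * Finite Cauchy products *)

Section CauchyProduct.
Variable A : pzRingType.

(** The Cauchy product takes the index pairs with [i + j < N] from the square; the corner
    [i + j >= N] remains. The ring is arbitrary so that this applies both to matrix terms and to
    their real majorants. *)
Lemma cauchy_product_remainder (a b : nat -> A) N :
  (\sum_(0 <= i < N) a i) * (\sum_(0 <= j < N) b j)
  - \sum_(0 <= k < N) \sum_(0 <= i < k.+1) a i * b (k - i)%N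
  = \sum_(0 <= i < N) \sum_(N - i <= j < N) a i * b j.
Proof.
have -> : \sum_(0 <= k < N) \sum_(0 <= i < k.+1) a i * b (k - i)%N
        = \sum_(0 <= i < N) \sum_(0 <= j < N - i) a i * b j.
  under [LHS]eq_big_nat => k /andP[_ kN] do rewrite (big_nat_widen 0 _ _ _ _ kN).
  rewrite (exchange_big_dep_nat predT) //=; apply: eq_big_nat => i _.
  under eq_bigl do rewrite ltnS.
  rewrite -(big_nat_widenl i 0 N predT) // -[in X in \sum_(X <= _ < _) _](add0n i) big_addn.
  by under eq_bigr do rewrite addnK.
rewrite mulr_suml -sumrB; apply: eq_big_nat => i _.
rewrite mulr_sumr (big_cat_nat (n := N - i)) ?leq_subr //=.
by rewrite [X in X - _]addrC addrK.
Qed.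

End CauchyProduct.

(** * The terms of exp(ad x) and the Leibniz rule *)

Section Derivation.
Variables (K : numFieldType) (n : nat) (x : 'M[K]_n).

(** Acts on all matrices, not only traceless ones, because the Leibniz rule concerns the associative
    product, which leaves sl_n. *)
Definition ad_mx (Y : 'M[K]_n) := x *m Y - Y *m x.

Definition ad_exp_term k Y := k`!%:R^-1 *: iter k ad_mx Y.

Lemma ad_mx_sum (I : Type) (r : seq I) (F : I -> 'M[K]_n) :
  ad_mx (\sum_(i <- r) F i) = \sum_(i <- r) ad_mx (F i).
Proof. by rewrite /ad_mx mulmx_sumr mulmx_suml -sumrB. Qed.

Lemma ad_mxZ c Y : ad_mx (c *: Y) = c *: ad_mx Y.
Proof. by rewrite /ad_mx -scalemxAr -scalemxAl scalerBr. Qed.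

Lemma ad_mxM Y Z : ad_mx (Y *m Z) = ad_mx Y *m Z + Y *m ad_mx Z.
Proof.
by rewrite /ad_mx mulmxBl mulmxBr !mulmxA addrA subrK.
Qed.

Lemma ad_exp_termD k Y Z : ad_exp_term k (Y + Z) = ad_exp_term k Y + ad_exp_term k Z.
Proof.
rewrite /ad_exp_term -scalerDr; congr (_ *: _).
by elim: k => //= k ->; rewrite /ad_mx mulmxDr mulmxDl opprD addrACA.
Qed.

Lemma ad_exp_term_scalar c k : ad_exp_term k.+1 c%:M = 0.
Proof.
rewrite /ad_exp_term iterSr /ad_mx scalar_mxC subrr -/ad_mx.
have -> : iter k ad_mx 0 = 0.
  by elim: k => //= k ->; rewrite /ad_mx mulmx0 mul0mx subrr.
by rewrite scaler0.
Qed.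

Lemma ad_exp_termS k Y : k.+1%:R *: ad_exp_term k.+1 Y = ad_mx (ad_exp_term k Y).
Proof.
by rewrite /ad_exp_term ad_mxZ scalerA factS natrM invfM mulrA mulfV ?mul1r ?pnatr_eq0.
Qed.

(** Dividing by factorials absorbs the binomials of the Leibniz rule. In the induction the
    derivation gives the term of index [i] the weights [i] and [k.+1 - i], which add up to
    [k.+1]. *)
Lemma ad_exp_termM k Y Z :
  ad_exp_term k (Y *m Z) = \sum_(0 <= i < k.+1) ad_exp_term i Y *m ad_exp_term (k - i) Z.
Proof.
elim: k => [|k IH]; first by rewrite big_nat1 /ad_exp_term /= invr1 !scale1r.
have k0 : (k.+1%:R : K) != 0 by rewrite pnatr_eq0.
apply: (scalerI k0); rewrite ad_exp_termS IH ad_mx_sum scaler_sumr.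
under eq_bigr => i _ do rewrite ad_mxM -!ad_exp_termS
    -(scalemxAl i.+1%:R) -(scalemxAr (k - i).+1%:R).
rewrite big_split /=.
pose F i := ad_exp_term i Y *m ad_exp_term (k.+1 - i) Z.
(* The boundary terms [i = 0] and [i = k.+1], missing from one sum each, have weight zero there, so
   both sums extend to a common range. *)
transitivity (\sum_(0 <= i < k.+2) i%:R *: F i
              + \sum_(0 <= i < k.+2) (k.+1 - i)%:R *: F i).
  congr (_ + _).
    rewrite [RHS]big_nat_recl //= scale0r add0r.
    by apply: eq_bigr => i _; rewrite /F subSS.
  rewrite [RHS]big_nat_recr //= subnn scale0r addr0.
  by apply: eq_big_nat => i /andP[_ ik]; rewrite /F subSn.
rewrite -big_split /=; apply: eq_big_nat => i /andP[_ ik].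
by rewrite -scalerDl -natrD subnKC.
Qed.

End Derivation.

(** * A submultiplicative matrix norm and the bound on the exponential terms *)

Section MatrixNorm.
Variables (R : realType) (n : nat).
Implicit Types (Y Z : 'M[R[i]]_n).

(** Valued in [R], hence comparable with the real exponential series; unlike the maximum of the
    entries it is submultiplicative. *)
Definition l1norm Y : R := \sum_i \sum_j normc (Y i j).

Lemma normc_ge0 (z : R[i]) : 0 <= normc z.
Proof. by case: z => a b; apply: sqrtr_ge0. Qed.

Lemma l1norm_ge0 Y : 0 <= l1norm Y.
Proof. by do 2! (apply: sumr_ge0 => ? _); apply: normc_ge0. Qed.

Lemma l1norm0 : l1norm 0 = 0.
Proof. by rewrite /l1norm !big1 // => i _; rewrite big1 // => j _; rewrite mxE normc0. Qed.

Lemma le_l1normD Y Z : l1norm (Y + Z) <= l1norm Y + l1norm Z.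
Proof.
rewrite /l1norm -big_split /=; apply: ler_sum => i _.
by rewrite -big_split /=; apply: ler_sum => j _; rewrite mxE; exact: le_normcD.
Qed.

Lemma l1normN Y : l1norm (- Y) = l1norm Y.
Proof. by apply: eq_bigr => i _; apply: eq_bigr => j _; rewrite mxE; exact: normcN. Qed.

Lemma l1normZ c Y : l1norm (c *: Y) = normc c * l1norm Y.
Proof.
rewrite /l1norm mulr_sumr; apply: eq_bigr => i _; rewrite mulr_sumr.
by apply: eq_bigr => j _; rewrite mxE normcM.
Qed.

Lemma le_l1norm_sum (I : Type) (r : seq I) (P : pred I) (F : I -> 'M[R[i]]_n) :
  l1norm (\sum_(i <- r | P i) F i) <= \sum_(i <- r | P i) l1norm (F i).
Proof.
elim/big_rec2: _ => [|i s Z _ le_sZ]; first by rewrite l1norm0.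
by apply: le_trans (le_l1normD _ _) _; rewrite lerD2l.
Qed.

Lemma le_normc_sum (I : Type) (r : seq I) (P : pred I) (F : I -> R[i]) :
  normc (\sum_(i <- r | P i) F i) <= \sum_(i <- r | P i) normc (F i).
Proof.
elim/big_rec2: _ => [|i s Z _ le_sZ]; first by rewrite normc0.
by apply: le_trans (le_normcD _ _) _; rewrite lerD2l.
Qed.

Lemma le_l1normM Y Z : l1norm (Y *m Z) <= l1norm Y * l1norm Z.
Proof.
rewrite {1 2}/l1norm mulr_suml; apply: ler_sum => i _.
rewrite mulr_suml.
apply: (@le_trans _ _ (\sum_j \sum_k normc (Y i k) * normc (Z k j))).
  apply: ler_sum => j _; rewrite mxE; apply: le_trans (le_normc_sum _ _ _) _.
  by apply: ler_sum => k _; rewrite normcM.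
rewrite exchange_big /=; apply: ler_sum => k _; rewrite -mulr_sumr.
apply: ler_wpM2l; first exact: normc_ge0.
rewrite /l1norm [leRHS](bigD1 k) //= lerDl.
by do 2! (apply: sumr_ge0 => ? _); apply: normc_ge0.
Qed.

Lemma l1norm_le0_eq0 Y : l1norm Y <= 0 -> Y = 0.
Proof.
move=> Yle0; apply/matrixP => i j; rewrite mxE; apply: eq0_normc.
apply/eqP; rewrite eq_le normc_ge0 andbT; apply: le_trans Yle0.
rewrite /l1norm (bigD1 i) //= (bigD1 j) //= -addrA lerDl addr_ge0 //.
  by apply: sumr_ge0 => ? _; apply: normc_ge0.
by do 2! (apply: sumr_ge0 => ? _); apply: normc_ge0.
Qed.

(** The two products in a commutator bound [ad_mx x] by the factor [2 * l1norm x]; divided by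
    [k.+1], this is the ratio of consecutive terms of the real exponential series. *)
Lemma le_l1norm_ad_exp_term x k Y :
  l1norm (ad_exp_term x k Y) <= l1norm Y * exp_coeff (2 * l1norm x) k.
Proof.
elim: k => [|k IH].
  by rewrite /ad_exp_term /exp_coeff /= fact0 invr1 scale1r expr0 divr1 mulr1.
have k0 : 0 < k.+1%:R :> R by rewrite ltr0n.
have normc_nat p : normc (p%:R : R[i]) = p%:R.
  by rewrite -[p%:R]/((1 : R[i]) *+ p) normcMn normc1.
rewrite -(ler_pM2l k0) -{1}(normc_nat k.+1) -l1normZ ad_exp_termS.
have -> : k.+1%:R * (l1norm Y * exp_coeff (2 * l1norm x) k.+1)
        = (2 * l1norm x) * (l1norm Y * exp_coeff (2 * l1norm x) k).
  rewrite /exp_coeff /= factS natrM exprS.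
  by rewrite /=; field; rewrite ?nat1r ?pnatr_eq0 -?lt0n ?fact_gt0.
apply: le_trans (le_l1normD _ _) _; rewrite l1normN -mulrA mulr_natl mulr2n.
apply: lerD; apply: le_trans (le_l1normM _ _) _; last rewrite mulrC;
  by apply: ler_wpM2l IH; apply: l1norm_ge0.
Qed.

End MatrixNorm.

(** Balls of matrices are defined entrywise, so one rank serves all entries. This carries the limit
    in [is_exp_ad] over to [l1norm]. *)
Lemma cvg_mx_entries (K : numFieldType) (m n : nat) (f : nat -> 'M[K]_(m, n))
    (L : 'M[K]_(m, n)) :
  f @ \oo --> L -> forall e : K, 0 < e ->
  \forall N \near \oo, forall i j, `|L i j - f N i j| < e.
Proof.
move=> fL e e0; move/cvg_ballP: fL => /(_ _ e0); apply: filterS => N [_ fNL] i j.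
exact: fNL.
Qed.

(** * Multiplicativity of the exponential of a derivation *)

Section ExponentialOfDerivation.
Variables (R : realType) (n : nat).
Implicit Types (x Y Z : 'M[R[i]]_n).

Definition ad_exp_sum x N Y := \sum_(0 <= k < N) ad_exp_term x k Y.

Lemma ad_exp_sumD x N Y Z : ad_exp_sum x N (Y + Z) = ad_exp_sum x N Y + ad_exp_sum x N Z.
Proof. by rewrite -big_split; apply: eq_bigr => k _; rewrite ad_exp_termD. Qed.

Lemma ad_exp_sum_scalar x c N : (0 < N)%N -> ad_exp_sum x N c%:M = c%:M.
Proof.
case: N => // N _; rewrite /ad_exp_sum big_nat_recl // big1 => [|k _].
  by rewrite /ad_exp_term /= invr1 scale1r addr0.
exact: ad_exp_term_scalar.
Qed.

(** The left side is a Cauchy product remainder by [ad_exp_termM], the real difference on the right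
    is one by the binomial theorem, and the two are compared term by term. *)
Lemma le_l1norm_ad_exp_sum_mul x Y Z N :
  l1norm (ad_exp_sum x N Y *m ad_exp_sum x N Z - ad_exp_sum x N (Y *m Z)) <=
  l1norm Y * l1norm Z * (series (exp_coeff (2 * l1norm x)) N ^+ 2
                   - series (exp_coeff (2 * l1norm x + 2 * l1norm x)) N).
Proof.
set e := exp_coeff (2 * l1norm x).
have -> : series (exp_coeff (2 * l1norm x + 2 * l1norm x)) N =
    \sum_(0 <= k < N) \sum_(0 <= i < k.+1) e i * e (k - i)%N.
  apply: eq_bigr => k _; rewrite /e /exp_coeff /= exprDn mulr_suml big_mkord.
  apply: eq_bigr => i _.
  have ik : (i <= k)%N by rewrite -ltnS.
  rewrite -(bin_fact ik) !natrM -mulr_natr.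
  by field; rewrite !pnatr_eq0 -!lt0n !fact_gt0 bin_gt0 ik.
have -> : ad_exp_sum x N (Y *m Z) =
    \sum_(0 <= k < N) \sum_(0 <= i < k.+1) ad_exp_term x i Y *m ad_exp_term x (k - i) Z.
  by apply: eq_bigr => k _; rewrite ad_exp_termM.
rewrite [ad_exp_sum x N Y *m _ - _](@cauchy_product_remainder 'M[R[i]]_n).
rewrite expr2 [_ * series _ _ - _](@cauchy_product_remainder R).
apply: le_trans (le_l1norm_sum _ _ _) _; rewrite mulr_sumr; apply: ler_sum => i _.
apply: le_trans (le_l1norm_sum _ _ _) _; rewrite mulr_sumr; apply: ler_sum => j _.
apply: le_trans (le_l1normM _ _) _; rewrite mulrACA.
by apply: ler_pM; rewrite ?l1norm_ge0 ?le_l1norm_ad_exp_term.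
Qed.

(** The norm of the defect [Phi (Y *m Z) - Phi Y *m Phi Z] does not depend on [N], yet is at most
    [b N] for every [N], where [b] tends to 0. *)
Lemma lim_ad_exp_sum_mulmx x (Phi : 'M[R[i]]_n -> 'M[R[i]]_n) :
    (forall Y, (fun N => l1norm (ad_exp_sum x N Y - Phi Y)) @ \oo --> (0 : R)) ->
  forall Y Z, Phi (Y *m Z) = Phi Y *m Phi Z.
Proof.
move=> lim_ad_exp_sum Y Z; apply/eqP; rewrite -subr_eq0; apply/eqP/l1norm_le0_eq0.
pose M := 2 * l1norm x.
pose u W := fun N => l1norm (ad_exp_sum x N W - Phi W).
pose r := fun N => series (exp_coeff M) N * series (exp_coeff M) N
                   - series (exp_coeff (M + M)) N.
have r0 : r @ \oo --> (0 : R).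
  have -> : (0 : R) = expR M * expR M - expR (M + M) by rewrite expRD subrr.
  by apply: cvgB; [apply: cvgM|]; apply: is_cvg_series_exp_coeff.
pose b := fun N => u (Y *m Z) N + l1norm Y * l1norm Z * r N + u Y N * u Z N
                   + u Y N * l1norm (Phi Z) + l1norm (Phi Y) * u Z N.
have b0 : b @ \oo --> (0 : R).
  have -> : (0 : R) = 0 + l1norm Y * l1norm Z * 0 + 0 * 0 + 0 * l1norm (Phi Z)
                      + l1norm (Phi Y) * 0 by rewrite !(mulr0, mul0r, addr0).
  by repeat (apply: cvgD || apply: cvgM || exact: cvg_cst || exact: lim_ad_exp_sum
             || exact: r0).
rewrite -(cvg_lim (@Rhausdorff R) b0); apply: limr_ge; first by apply/cvg_ex; exists 0.
apply: nearW => N.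
(* The defect is split into the error at [Y *m Z], the Cauchy remainder and three products
   containing the errors at [Y] or [Z]; the summands of [b] bound them in this order. *)
have -> : Phi (Y *m Z) - Phi Y *m Phi Z =
    - (ad_exp_sum x N (Y *m Z) - Phi (Y *m Z))
    - (ad_exp_sum x N Y *m ad_exp_sum x N Z - ad_exp_sum x N (Y *m Z))
    + (ad_exp_sum x N Y - Phi Y) *m (ad_exp_sum x N Z - Phi Z)
    + (ad_exp_sum x N Y - Phi Y) *m Phi Z
    + Phi Y *m (ad_exp_sum x N Z - Phi Z).
  rewrite !(mulmxBl, mulmxBr) !opprB.
  move: (ad_exp_sum x N Y *m ad_exp_sum x N Z) (Phi Y *m Phi Z) (ad_exp_sum x N Y *m Phi Z)
        (Phi Y *m ad_exp_sum x N Z) (Phi (Y *m Z)) (ad_exp_sum x N (Y *m Z)).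
  by move=> a1 a2 a3 a4 a5 a6; apply/matrixP => i j; rewrite !mxE; ring.
rewrite /b.
do 3 (apply: le_trans (le_l1normD _ _) _; apply: lerD; last exact: le_l1normM).
apply: le_trans (le_l1normD _ _) _; rewrite !l1normN; apply: lerD => //.
by rewrite /r -expr2; apply: le_l1norm_ad_exp_sum_mul.
Qed.

Lemma cvg_l1norm (f : nat -> 'M[R[i]]_n) (L : 'M[R[i]]_n) :
    (forall e : R[i], 0 < e ->
      \forall N \near \oo, forall i j, `|L i j - f N i j| < e) ->
  (fun N => l1norm (f N - L)) @ \oo --> (0 : R).
Proof.
move=> fL.
have fLij i j : (fun N => normc ((f N - L) i j)) @ \oo --> (0 : R).
  apply/cvgrPdist_lt => e e0.
  have e0' : 0 < e%:C%C :> R[i] by rewrite ltcR.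
  apply: filterS (fL _ e0') => N /(_ i j).
  by rewrite -ltcR sub0r normrN (ger0_norm (normc_ge0 _)) distrC !mxE.
have -> : (0 : R) = \sum_(i < n) \sum_(j < n) 0.
  by rewrite big1 // => i _; rewrite big1.
by rewrite /l1norm; do 2! (apply: cvg_big => [|? _]; first exact: add_continuous).
Qed.

End ExponentialOfDerivation.

(** * Unital endomorphisms of a matrix algebra *)

Section SkolemNoether.
Variables (F : fieldType) (n : nat).

(* If Phi(E_00) v <> 0, the matrix P with columns Phi(E_k0) v intertwines. *)
Lemma skolem_noether (Phi : {linear 'M[F]_n -> 'M[F]_n}) :
    (0 < n)%N -> Phi 1%:M = 1%:M ->
    (forall A B, Phi (A *m B) = Phi A *m Phi B) ->
  exists2 P, P \in unitmx & forall A, Phi A *m P = P *m A.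
Proof.
case: n Phi => // p Phi _ Phi1 PhiM.
have [v vP] : exists v : 'cV[F]_p.+1, Phi (delta_mx 0 0) *m v != 0.
  apply: contrapT => H.
  have E0 : Phi (delta_mx 0 0) = 0.
    apply/matrixP => i j; rewrite mxE; apply: contrapT => ne; apply: H.
    exists (delta_mx j 0); apply/eqP => /matrixP/(_ i 0).
    by rewrite -colE !mxE => /ne.
  (* Since 1 is the sum of the [E_i0 E_00 E_0i], [Phi(E_00) = 0] would give [Phi 1 = 0]. *)
  have := Phi1; rewrite {1}mx1_sum_delta linear_sum big1 => [|i _].
    move/matrixP/(_ 0 0); rewrite !mxE /= => /eqP.
    by rewrite eq_sym oner_eq0.
  rewrite -(mul_delta_mx (0 : 'I_p.+1) i i) -(mul_delta_mx (0 : 'I_p.+1) 0 i).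
  by rewrite !PhiM E0 mul0mx mulmx0.
pose P : 'M[F]_p.+1 := \matrix_(i, k) (Phi (delta_mx k 0) *m v) i 0.
have col_P k : col k P = Phi (delta_mx k 0) *m v.
  by apply/colP => i; rewrite !mxE.
have PhiP A : Phi A *m P = P *m A.
  apply/matrixP => i k.
  have -> : (Phi A *m P) i k = (Phi (A *m delta_mx k 0) *m v) i 0.
    by rewrite PhiM -mulmxA -col_P !mxE; apply: eq_bigr => l _; rewrite [col k P _ _]mxE.
  have -> : A *m delta_mx k 0 = \sum_l A l k *: delta_mx l (0 : 'I_p.+1).
    apply/matrixP => a b; rewrite !mxE summxE.
    rewrite (bigD1 k) //= big1 ?addr0 => [|l /negPf lk]; rewrite !mxE ?lk ?mulr0 //.
    rewrite (bigD1 a) //= big1 ?addr0 => [|l /negPf la]; rewrite !mxE ?eqxx //.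
    by rewrite eq_sym la mulr0.
  rewrite linear_sum mulmx_suml summxE mxE; apply: eq_bigr => l _.
  by rewrite linearZ -scalemxAl !mxE mulrC.
(* If [P u = 0] with [u_l] nonzero, then [u_l P e_0 = P E_0l u = Phi(E_0l) P u = 0], but
   [P e_0 = Phi(E_00) v] is nonzero. *)
exists P => //; rewrite -unitmx_tr -row_free_unit -kermx_eq0; apply: contraT.
case/rowV0Pn => u /sub_kermxP /(congr1 trmx); rewrite trmx_mul trmxK trmx0 => Pu0 u0.
have [l ul] : exists l, u 0 l != 0.
  apply: contrapT => H; case/negP: u0; apply/eqP/rowP => l; rewrite mxE.
  by apply: contrapT => ne; apply: H; exists l; apply/eqP.
case/negP: vP; rewrite -col_P.
have -> : col 0 P = (u 0 l)^-1 *: (P *m (delta_mx 0 l *m u^T)).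
  rewrite colE [delta_mx 0 0](_ : _ = (u 0 l)^-1 *: (delta_mx 0 l *m u^T)) ?scalemxAr //.
  apply/colP => i; rewrite !mxE (bigD1 l) //= big1 ?addr0 => [|k /negPf kl].
    by rewrite !mxE !eqxx andbT mulVf ?mulr1.
  by rewrite mxE kl andbF mul0r.
by rewrite mulmxA -PhiP -mulmxA Pu0 mulmx0 scaler0.
Qed.

End SkolemNoether.

(** * Members of Int(sl_n) as conjugations *)

Section InnerAutomorphisms.
Variables (R : realType) (n : nat).
Hypothesis n_gt0 : (0 < n)%N.
Implicit Types (x y : slT R[i] n) (phi psi : 'End(slT R[i] n)).

(** Free of inverses, which eases composition and iteration; it means conjugation by [P] when [P] is
    invertible. *)
Definition conjugation_by phi (P : 'M[R[i]]_n) :=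
  forall y, vsval (phi y) *m P = P *m vsval y.

Lemma scalar_tracelessP (Y : 'M[R[i]]_n) :
  Y - (\tr Y / n%:R)%:M \in sln R[i] n.
Proof.
rewrite mem_sln linearB /= mxtrace_scalar -(mulr_natr (_ / _)) divfK ?subrr //.
by rewrite pnatr_eq0 -lt0n.
Qed.

Lemma val_iter_lie_bracket x k y :
  vsval (iter k (lie_bracket x) y) = iter k (ad_mx (vsval x)) (vsval y).
Proof. by elim: k => //= k ->. Qed.

(** Matrices split into sl_n plus scalars; [phi] is extended by the identity on scalars. [vsproj]
    only retypes a matrix that is already traceless. *)
Definition extend_scalars phi (Y : 'M[R[i]]_n) : 'M[R[i]]_n :=
  vsval (phi (vsproj (sln R[i] n) (Y - (\tr Y / n%:R)%:M))) + (\tr Y / n%:R)%:M.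

Lemma extend_scalars_linear phi : linear (extend_scalars phi).
Proof.
move=> c Y Z; rewrite /extend_scalars.
have -> : (\tr (c *: Y + Z) / n%:R)%:M =
   c *: (\tr Y / n%:R)%:M + (\tr Z / n%:R)%:M :> 'M[R[i]]_n.
  by rewrite linearD linearZ /= mulrDl -mulrA raddfD /= -scale_scalar_mx.
rewrite opprD addrACA -scalerBr !linearP /= scalerDr !addrA; congr (_ + _).
by rewrite addrAC.
Qed.

Lemma extend_scalars_sl phi y : extend_scalars phi (vsval y) = vsval (phi y).
Proof.
have /eqP tr0 : \tr (vsval y) == 0 by rewrite -mem_sln subvsP.
by rewrite /extend_scalars tr0 mul0r raddf0 subr0 addr0 vsvalK.
Qed.

Lemma extend_scalars1 phi : extend_scalars phi 1%:M = 1%:M.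
Proof.
rewrite /extend_scalars mxtrace1 divff ?pnatr_eq0 -?lt0n //.
by rewrite subrr !linear0 add0r.
Qed.

Lemma exp_ad_conj x phi : is_exp_ad x phi ->
  exists2 P, P \in unitmx & conjugation_by phi P.
Proof.
move=> expx.
pose Phi : {linear 'M[R[i]]_n -> 'M[R[i]]_n} := HB.pack (extend_scalars phi)
  (GRing.isLinear.Build _ _ _ _ _ (extend_scalars_linear phi)).
have lim_ad_exp_sum Y : (fun N => l1norm (ad_exp_sum (vsval x) N Y - Phi Y)) @ \oo --> (0 : R).
  apply: cvg_l1norm => e e0; set c := \tr Y / n%:R.
  pose y := vsproj (sln R[i] n) (Y - c%:M).
  have vy : vsval y = Y - c%:M by rewrite vsprojK ?scalar_tracelessP.
  have := cvg_mx_entries (expx y) e0.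
  (* A partial sum fixes scalars only if it contains the term of index 0, hence the ranks from 1
     on. *)
  apply: filter_app; exists 1%N => // N N1 + i j => /(_ i j).
  have -> : ad_exp_sum (vsval x) N Y = ad_exp_sum (vsval x) N (vsval y) + c%:M.
    by rewrite -(ad_exp_sum_scalar (vsval x) c N1) -ad_exp_sumD vy subrK.
  have -> : Phi Y i j = vsval (phi y) i j + c%:M i j.
    by rewrite /= /extend_scalars mxE.
  rewrite [(_ + c%:M) i j]mxE opprD addrACA subrr addr0.
  congr (`|_ - _| < _). rewrite /series /ad_exp_sum /=; congr (fun_of_matrix _ i j).
  by apply: eq_bigr => k _; rewrite val_iter_lie_bracket.
have [P Pu PhiP] := skolem_noether (Phi := Phi) n_gt0 (extend_scalars1 phi)
  (lim_ad_exp_sum_mulmx lim_ad_exp_sum).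
by exists P => // y; rewrite -extend_scalars_sl; exact: PhiP.
Qed.

Lemma Int_conj phi : Int phi -> exists2 P, P \in unitmx & conjugation_by phi P.
Proof.
elim=> [x psi /exp_ad_conj // | | psi1 psi2 _ [P Pu PP] _ [Q Qu QP]|psi _ [P Pu PP]].
- by exists 1%:M; rewrite ?unitmx1 // => y; rewrite id_lfunE mulmx1 mul1mx.
- exists (P *m Q); rewrite ?unitmx_mul ?Pu // => y.
  by rewrite comp_lfunE mulmxA PP -!mulmxA QP.
(* Conjugation is injective, which makes the pseudo-inverse of [psi] a true inverse. *)
have ker0 : lker psi == 0%VS.
  apply/lker0P => y z yz; apply: val_inj; rewrite /=.
  by apply: (can_inj (mulKmx Pu)); rewrite -!PP yz.
exists (invmx P); rewrite ?unitmx_inv // => y.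
apply: (can_inj (mulKmx Pu)); rewrite mulmxA -PP mulmxK //.
by rewrite lker0_lfunVK // mulKVmx.
Qed.

End InnerAutomorphisms.

(** * The Z-grading attached to a basis with integer weights *)

Section DiagonalGrading.
Variables (K : numFieldType) (n : nat) (V : 'M[K]_n) (a : 'I_n -> nat).
Hypothesis Vu : V \in unitmx.
Implicit Types (x y : slT K n) (Q : pred int).

(** The matrix of [x], acting on row vectors, in the basis formed by the rows of [V]. *)
Definition coord_mx x : 'M[K]_n := V *m vsval x *m invmx V.

Definition degree (i j : 'I_n) : int := (a i)%:Z - (a j)%:Z.

Lemma coord_mx_linear : linear coord_mx.
Proof.
move=> c x y; rewrite /coord_mx [vsval (_ + _)]linearP mulmxDr mulmxDl.
by rewrite -scalemxAr -scalemxAl.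
Qed.

HB.instance Definition _ := GRing.isLinear.Build _ _ _ _ coord_mx coord_mx_linear.

Lemma coord_mx_inj : injective coord_mx.
Proof.
move=> x y /(can_inj (mulmxKV Vu)) /(can_inj (mulKmx Vu)).
exact: val_inj.
Qed.

Definition off_support Q x : 'M[K]_n :=
  \matrix_(i, j) if Q (degree i j) then 0 else coord_mx x i j.

Lemma off_supportE Q x i j :
  off_support Q x i j = if Q (degree i j) then 0 else coord_mx x i j.
Proof. by rewrite mxE. Qed.

Lemma off_support_linear Q : linear (off_support Q).
Proof.
move=> c x y; apply/matrixP => i j.
rewrite off_supportE [RHS]mxE [X in _ = X + _]mxE !off_supportE coord_mx_linear.
by case: ifP => _; [rewrite mulr0 addr0 | rewrite mxE [X in X + _]mxE].
Qed.

HB.instance Definition _ Q :=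
  GRing.isLinear.Build _ _ _ _ (off_support Q) (off_support_linear Q).

(** A general predicate covers all spaces at once: [pred1 k] gives a graded piece, a residue class a
    piece of the cyclic grading, [predT] everything. *)
Definition supported Q : {vspace slT K n} := lker (linfun (off_support Q)).

Lemma supportedP Q x :
  reflect (forall i j, coord_mx x i j != 0 -> Q (degree i j)) (x \in supported Q).
Proof.
rewrite memv_ker lfunE /=; apply: (iffP eqP) => [/matrixP x0 i j | xQ].
  by have := x0 i j; rewrite off_supportE [RHS]mxE; case: ifP => // _ ->; rewrite eqxx.
apply/matrixP => i j; rewrite off_supportE [RHS]mxE; case: ifP => // /negP nQ.
by apply/eqP/negPn/negP => /xQ.
Qed.

(** Diagonal entries have degree 0: the part of degree 0 keeps the whole trace, which is 0, and the
    other parts have zero diagonal. *)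
Lemma degree_part_subproof (k : int) x :
  invmx V *m (\matrix_(i, j) if degree i j == k then coord_mx x i j else 0) *m V
    \in sln K n.
Proof.
rewrite mem_sln mxtrace_mulC mulmxA mulmxV // mul1mx.
have [<-|k0] := eqVneq 0 k; last first.
  by rewrite /mxtrace big1 // => i _; rewrite mxE /degree subrr (negPf k0).
have -> : \tr (\matrix_(i, j) if degree i j == 0 then coord_mx x i j else 0)
        = \tr (coord_mx x).
  by apply: eq_bigr => i _; rewrite mxE /degree subrr eqxx.
by rewrite /coord_mx mxtrace_mulC mulmxA mulVmx // mul1mx -mem_sln subvsP.
Qed.

Definition degree_part k x : slT K n := Subvs (degree_part_subproof k x).

Lemma coord_degree_part k x i j :
  coord_mx (degree_part k x) i j = if degree i j == k then coord_mx x i j else 0.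
Proof. by rewrite {1}/coord_mx /= !mulmxA mulmxV // mul1mx mulmxK // mxE. Qed.

Lemma sum_supported_sub (s : seq int) Q :
  (\sum_(k <- s | Q k) supported (pred1 k) <= supported [pred k | (k \in s) && Q k])%VS.
Proof.
rewrite big_seq_cond; apply: (big_ind (fun U => U <= _)%VS).
- exact: sub0v.
- by move=> U W UQ WQ; rewrite subv_add UQ.
move=> k ksQ; apply/subvP => x /supportedP xk; apply/supportedP => i j /xk /=.
by move/eqP->.
Qed.

(** An entry has only one degree, so a piece whose degree is not in a list meets the sum over that
    list trivially. *)
Lemma directv_supported (s : seq int) Q : uniq s ->
  directv (\sum_(k <- s | Q k) supported (pred1 k)).
Proof.
rewrite directvE /=; elim: s => [|k s IH] /=; first by rewrite !big_nil dimv0.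
case/andP=> ks us; rewrite !big_cons; case: ifP => Qk; last exact: IH.
rewrite dimv_disjoint_sum ?(eqP (IH us)) //.
apply/eqP; rewrite -subv0; apply/subvP => x; rewrite memv_cap memv0.
case/andP=> /supportedP xk /(subvP (sum_supported_sub s Q)) /supportedP xs.
apply/eqP/coord_mx_inj/matrixP => i j; rewrite linear0 [RHS]mxE.
apply/eqP/negPn/negP => nz; have /eqP kE := xk _ _ nz.
by have := xs _ _ nz; rewrite kE /= (negPf ks).
Qed.

Lemma direct_sum_supported Q :
  is_direct_sum (fun k => supported (pred1 k)) Q (supported Q).
Proof.
split=> [s us|x]; first exact: directv_supported.
split=> [/supportedP xQ|[s /(subvP (sum_supported_sub s Q)) /supportedP xs]].
  (* The finitely many degrees that occur, each listed once so that every entry is recovered exactly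
     once. *)
  pose s := undup [seq degree p.1 p.2 | p : 'I_n * 'I_n].
  exists s; have -> : x = \sum_(k <- s | Q k) degree_part k x.
    apply: coord_mx_inj; apply/matrixP => i j; rewrite linear_sum summxE.
    under eq_bigr do rewrite coord_degree_part.
    have [x0|/xQ Qij] := eqVneq (coord_mx x i j) 0.
      by rewrite x0 big1 // => k _; rewrite if_same.
    have ijs : degree i j \in s.
      by rewrite mem_undup; apply/mapP; exists (i, j); rewrite ?mem_enum.
    rewrite big_mkcond (bigD1_seq (degree i j)) ?undup_uniq //= Qij eqxx.
    by rewrite big1 ?addr0 // => k /negPf kij; rewrite eq_sym kij if_same.
  elim/big_rec2: _ => [|k y U _ yU]; first exact: mem0v.
  apply: memv_add => //; apply/supportedP => i j.
  by rewrite coord_degree_part /=; case: ifP; rewrite ?eqxx.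
by apply/supportedP => i j /xs /andP[].
Qed.

Lemma coord_lie_bracket x y :
  coord_mx (lie_bracket x y)
  = coord_mx x *m coord_mx y - coord_mx y *m coord_mx x.
Proof.
have coordM (A B : 'M[K]_n) :
    V *m A *m invmx V *m (V *m B *m invmx V) = V *m (A *m B) *m invmx V.
  by rewrite !mulmxA mulmxKV.
by rewrite /coord_mx /= !coordM mulmxBr mulmxBl.
Qed.

Lemma mul_coord_neq0 x y i j (P Q : pred int) :
    x \in supported P -> y \in supported Q ->
    (coord_mx x *m coord_mx y) i j != 0 ->
  exists l, P (degree i l) /\ Q (degree l j).
Proof.
move=> /supportedP xP /supportedP yQ; rewrite mxE => nz.
apply: contrapT => H; case/negP: nz; rewrite big1 // => l _; apply/eqP.
rewrite mulf_eq0; apply/negPn/negP; rewrite negb_or => /andP[/xP ? /yQ ?].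
by apply: H; exists l.
Qed.

Lemma supported_bracket (k l : int) x y :
    x \in supported (pred1 k) -> y \in supported (pred1 l) ->
  lie_bracket x y \in supported (pred1 (k + l)).
Proof.
move=> xk yl; apply/supportedP => i j; rewrite coord_lie_bracket => nz /=.
have degD p q r : degree p q + degree q r = degree p r.
  by rewrite /degree addrA subrK.
have [xy0|/(mul_coord_neq0 xk yl)] := eqVneq ((coord_mx x *m coord_mx y) i j) 0.
  have [yx0|/(mul_coord_neq0 yl xk)] := eqVneq ((coord_mx y *m coord_mx x) i j) 0.
    by move: nz; rewrite mxE [X in _ + X]mxE xy0 yx0 subrr eqxx.
  by case=> p [/eqP <- /eqP <-]; rewrite addrC degD.
by case=> p [/eqP <- /eqP <-]; rewrite degD.
Qed.

Lemma Z_grading_supported : Z_grading (fun k => supported (pred1 k)).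
Proof.
split; last exact: supported_bracket.
suff -> : fullv = supported predT by exact: direct_sum_supported.
by apply/vspaceP => x; rewrite memvf; apply/esym/supportedP.
Qed.

End DiagonalGrading.

(** * The primitive root [zeta] and its integer powers *)

Section RootOfUnity.
Variables (R : realType) (m : nat).
Hypothesis m_gt0 : (0 < m)%N.

Lemma zetaX k : zeta R m ^+ k =
  (cos (k%:R * (2 * pi / m%:R)) +i* sin (k%:R * (2 * pi / m%:R)))%C.
Proof.
elim: k => [|k IH]; first by rewrite mul0r cos0 sin0.
rewrite exprS IH /zeta; move: (2 * pi / m%:R) => t.
rewrite -[k.+1%:R]natr1 mulrDl mul1r cosD sinD.
apply/eqP; rewrite eq_complex /=; apply/andP; split; apply/eqP; ring.
Qed.

Lemma zeta_prim : m.-primitive_root (zeta R m).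
Proof.
have m0 : m%:R != 0 :> R by rewrite pnatr_eq0 -lt0n.
apply/andP; split => //; apply/forallP => i; apply/eqP; rewrite unity_rootE.
have angle : i.+1%:R * (2 * pi / m%:R) = (i.+1%:R * pi / m%:R) *+ 2 :> R.
  by rewrite -mulr_natr; field.
rewrite zetaX angle; have [->|im] := eqVneq i.+1 m.
  rewrite [_ * _ / _](_ : _ = pi) ?cos2pi ?sin2pi ?eqxx //.
  by rewrite mulrAC divff ?mul1r.
apply/negP => /eqP [cos1 _].
(* The half angle [t] lies strictly between 0 and pi, so sin t > 0, while cos 2t = 1 forces sin t =
   0. *)
have : 0 < sin (i.+1%:R * pi / m%:R : R).
  apply: sin_gt0_pi; rewrite divr_gt0 ?mulr_gt0 ?pi_gt0 ?ltr0n //=.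
  rewrite ltr_pdivrMr ?ltr0n // mulrC ltr_pM2l ?pi_gt0 // ltr_nat.
  by rewrite ltn_neqAle im ltn_ord.
move: cos1; rewrite mulr2n cosD -!expr2 cos2sin2 => /eqP.
have -> : 1 - sin (i.+1%:R * pi / m%:R) ^+ 2 - sin (i.+1%:R * pi / m%:R) ^+ 2
        = 1 - sin (i.+1%:R * pi / m%:R) ^+ 2 *+ 2 :> R by rewrite mulr2n; ring.
rewrite subr_eq -[X in X == _]addr0 (inj_eq (addrI _)) eq_sym mulrn_eq0 /=.
by rewrite sqrf_eq0 => /eqP ->; rewrite ltxx.
Qed.

End RootOfUnity.

Lemma prim_root_exprz_eq (F : fieldType) (m : nat) (z : F) (j k : int) :
  m.-primitive_root z -> (z ^ j == z ^ k) = (j == k %[mod m])%Z.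
Proof.
move=> zm; have z0 : z != 0.
  by rewrite (prim_root_eq0 zm) -lt0n (prim_order_gt0 zm).
have zk0 (l : int) : z ^ l != 0 by rewrite expfz_eq0 negb_and z0 orbT.
have z1 (l : int) : (z ^ l == 1) = (m %| l)%Z.
  case: l => p; first by rewrite -exprnP -(prim_order_dvd zm).
  by rewrite NegzE dvdzE abszN -invr_expz invr_eq1 -exprnP -(prim_order_dvd zm).
rewrite eqz_mod_dvd -z1 expfzDr // -invr_expz -[RHS](inj_eq (mulIf (zk0 k))).
by rewrite mulfVK ?mul1r.
Qed.

(** * Central matrices and matrices of finite order *)

Lemma comm_mx_all_scalar (F : fieldType) (n : nat) (A : 'M[F]_n.+1) :
  (forall B, A *m B = B *m A) -> A = (A 0 0)%:M.
Proof.
move=> cA; apply/matrixP => i j.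
(* The entry [(i, 0)] of [A E_j0] is [A i j]; that of [E_j0 A] is [A 0 0] if [i = j], and 0
   otherwise. *)
have /matrixP/(_ i 0) := cA (delta_mx j 0); rewrite !mxE.
rewrite (bigD1 j) //= big1 ?addr0 => [|k /negPf kj]; last by rewrite mxE kj mulr0.
rewrite (bigD1 0) //= big1 ?addr0 => [|k /negPf kj]; last by rewrite mxE kj andbF mul0r.
by rewrite !mxE !eqxx !andbT mulr1 mulr_natl => ->.
Qed.

(** The minimal polynomial divides X^m - 1, which splits with distinct roots [z ^+ i]. Exponents are
    taken in ['I_m] so that their differences stay below [m] in absolute value. *)
Lemma finite_order_diagonalizable (F : fieldType) (n m : nat) (z : F)
    (Q : 'M[F]_n.+1) :
  m.-primitive_root z -> Q ^+ m = 1 ->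
  exists V : 'M[F]_n.+1, exists2 a : 'I_n.+1 -> 'I_m, V \in unitmx &
    V *m Q = diag_mx (\row_i z ^+ a i) *m V.
Proof.
move=> zm Qm.
have [V Vu /similar_diagPex [d /(similarP Vu) VQ]] : diagonalizable Q.
  apply/diagonalizableP; exists [seq z ^+ i | i <- index_iota 0 m].
    rewrite map_inj_in_uniq ?iota_uniq // => i j; rewrite !mem_index_iota /=.
    move=> im jm /eqP; rewrite (eq_prim_root_expr zm) !modn_small //.
    by move/eqP.
  rewrite big_map (factor_Xn_sub_1 zm); apply: mxminpoly_min.
  by rewrite rmorphB rmorphXn /= horner_mx_X rmorph1 Qm subrr.
have VQk k : V *m Q ^+ k = diag_mx (\row_i d 0 i ^+ k) *m V.
  elim: k => [|k IH].
    rewrite mulmx1 [diag_mx _](_ : _ = 1%:M) ?mul1mx //.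
    by apply/matrixP => i j; rewrite !mxE.
  rewrite exprS mulmxA VQ -mulmxA IH mulmxA; congr (_ *m _).
  by apply/matrixP => i j; rewrite mul_diag_mx !mxE exprS mulrnAr.
have dm i : d 0 i ^+ m = 1.
  have := VQk m; rewrite Qm mulmx1 => /(congr1 (mulmx^~ (invmx V))) /=.
  rewrite mulmxK // mulmxV // => /matrixP/(_ i i).
  by rewrite !mxE eqxx.
exists V; exists (fun i => sval (prim_rootP zm (dm i))) => //.
rewrite VQ; congr (diag_mx _ *m V); apply/rowP => i; rewrite mxE.
by case: prim_rootP.
Qed.

Section FiniteOrder.
Variables (R : realType) (n m : nat) (theta : 'End(slT R[i] n.+1)).
Hypothesis theta_order : has_order theta m.

(** As [theta] iterated [m] times is the identity, [P ^+ m] commutes with sl_n, hence, adding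
    scalars, with every matrix. *)
Lemma finite_order_conj_scalar P : P \in unitmx -> conjugation_by theta P ->
  exists2 c, c != 0 & P ^+ m = c%:M.
Proof.
move=> Pu thetaP.
have thetaPk k y : vsval (iter k theta y) *m P ^+ k = P ^+ k *m vsval y.
  elim: k y => [|k IH] y; first by rewrite mulmx1 mul1mx.
  by rewrite exprSr iterSr mulmxA IH -mulmxA thetaP mulmxA.
have [_ theta_m _] := theta_order.
have cP (B : 'M[R[i]]_n.+1) : P ^+ m *m B = B *m P ^+ m.
  have := thetaPk m (vsproj (sln _ _) (B - (\tr B / n.+1%:R)%:M)).
  rewrite theta_m vsprojK ?scalar_tracelessP // mulmxBl mulmxBr scalar_mxC.
  by move/addIr.
exists ((P ^+ m) 0 0); last exact: comm_mx_all_scalar.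
apply/eqP => c0; have : P ^+ m \in unitmx by apply: (unitrX m Pu).
by rewrite (comm_mx_all_scalar cP) c0 raddf0 unitr0.
Qed.

End FiniteOrder.

(** * The grading by differences of eigenvalue exponents *)

Theorem corollary2p30 (R : realType) (n m : nat) (hn : (2 <= n)%N)
    (hm : (0 < m)%N) (theta : 'End(slT R[i] n))
    (htheta : Int theta) (hord : has_order theta m) :
  exists g : int -> {vspace slT R[i] n},
    [/\ Z_grading g,
        lifts m (cyclic_grading m theta) g &
        forall j : int, (m <= `|j|)%N -> g j = 0%VS].
Proof.
case: n hn theta htheta hord => // p _ theta htheta hord.
have [P Pu thetaP] := Int_conj (ltn0Sn p) htheta.
have [c c0 Pm] := finite_order_conj_scalar hord Pu thetaP.
(* Dividing [P] by an m-th root of [c] makes its m-th power 1 and leaves the conjugation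
   unchanged. *)
pose r := m.-root c.
have rm : r ^+ m = c by rewrite rootCK.
have r0 : r != 0 by apply: contraNneq c0 => r0; rewrite -rm r0 expr0n gtn_eqF.
have zm := zeta_prim R hm.
have [V [a Vu VQ]] : exists V : 'M[R[i]]_p.+1, exists2 a : 'I_p.+1 -> 'I_m,
    V \in unitmx & V *m (r^-1 *: P) = diag_mx (\row_i zeta R m ^+ a i) *m V.
  apply: finite_order_diagonalizable => //.
  by rewrite exprZn Pm scale_scalar_mx exprVn rm mulVf.
set D := diag_mx _ in VQ.
have thetaD y : coord_mx V (theta y) *m D = D *m coord_mx V y.
  have -> : D = V *m (r^-1 *: P) *m invmx V by rewrite VQ mulmxK.
  rewrite /coord_mx !mulmxA !mulmxKV // -!scalemxAr -!scalemxAl.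
  by rewrite -[V *m _ *m P]mulmxA thetaP mulmxA.
exists (fun k => supported V a (pred1 k)); split.
- exact: Z_grading_supported.
- move=> j; suff -> : cyclic_grading m theta j
      = supported V a (fun k => (k == j %[mod m])%Z) by exact: direct_sum_supported.
  apply/vspaceP => x.
  transitivity (theta x == zeta R m ^ j *: x); first exact: mem_cyclic_grading.
  have z0 : zeta R m != 0 by rewrite (prim_root_eq0 zm) -lt0n.
  (* Conjugation by the diagonal matrix [D] multiplies the entry [(i, l)] by the quotient of its
     eigenvalues of indices [i] and [l]. *)
  have entry i l : coord_mx V (theta x) i l
                 = zeta R m ^ degree a i l * coord_mx V x i l.
    have /matrixP/(_ i l) := thetaD x; rewrite mul_mx_diag mul_diag_mx.
    rewrite [LHS]mxE [RHS]mxE [X in _ * X]mxE [X in _ = X * _]mxE => E.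
    apply: (mulIf (expf_neq0 (a l) z0)); rewrite E /degree expfzDr //.
    by rewrite -invr_expz -!exprnP mulrAC mulfVK ?expf_neq0.
  have entryZ i l : coord_mx V (zeta R m ^ j *: x) i l
                  = zeta R m ^ j * coord_mx V x i l.
    by rewrite linearZ [LHS]mxE.
  (* Compared entrywise, the eigenvalue equation says that each nonzero coordinate has degree
     congruent to [j] modulo [m]. *)
  apply/eqP/supportedP => [tx i l nz | xj].
    rewrite -(prim_root_exprz_eq _ _ zm); apply/eqP/(mulIf nz).
    by rewrite -entry tx entryZ.
  apply: (coord_mx_inj Vu); apply/matrixP => i l; rewrite entry entryZ.
  have [->|/xj] := eqVneq (coord_mx V x i l) 0; first by rewrite !mulr0.
  by rewrite -(prim_root_exprz_eq _ _ zm) => /eqP ->.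
- move=> j mj; apply/eqP; rewrite -subv0; apply/subvP => x /supportedP xj.
  rewrite memv0; apply/eqP/(coord_mx_inj Vu)/matrixP => i l.
  rewrite linear0 [RHS]mxE; apply/eqP/negPn/negP => /xj /eqP jE.
  move: mj; rewrite -jE /degree; apply/negP; rewrite -ltnNge.
  move: (ltn_ord (a i)) (ltn_ord (a l)); lia.
Qed.
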